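(* Let $f:\mathbb R^m\to\mathbb R$ belong to $\mathcal S^{1,1}_{\mu_f,L_f}$ and $g:\mathbb R^n\to\mathbb R$ belong to $\mathcal S^{1,1}_{\mu_g,L_g}$ with $\mu_f,\mu_g\ge 0$. Let $A\in\mathbb R^{r\times m}$, $B\in\mathbb R^{r\times n}$, $b\in\mathbb R^r$, let $\mathcal L(x,y,\lambda)=f(x)+g(y)+\langle\lambda,Ax+By-b\rangle$, and let $(x^*,y^*,\lambda^* )$ be a saddle point of $\mathcal L$. Let $\Theta=(\theta,\gamma,\beta)$ solve $$\theta'=-\theta,\quad \gamma'=\mu_f-\gamma,\quad \beta'=\mu_g-\beta,\qquad \theta(0)=1,\ \gamma(0)=\gamma_0>0,\ \beta(0)=\beta_0>0,$$ and let $X=(x,y,v,w,\lambda)$ be the unique $C^1$ solution on $[0,\infty)$ (with given initial data) of $$\begin{cases}x'=v-x,\\ \gamma v'=\mu_f(x-v)-\nabla_x\mathcal L(x,y,\lambda),\\ \theta\lambda'=\nabla_\lambda\mathcal L(v,w,\lambda)=Av+Bw-b,\\ \beta w'=\mu_g(y-w)-\nabla_y\mathcal L(x,y,\lambda),\\ y'=w-y.\end{cases}$$ Define $$\mathcal E(\Theta,X)=\mathcal L(x,y,\lambda^* )-\mathcal L(x^*,y^*,\lambda)+\frac{\theta}{2}\|\lambda-\lambda^*\|^2+\frac{\beta}{2}\|w-y^*\|^2+\frac{\gamma}{2}\|v-x^*\|^2 .$$ Then $$\frac{\mathrm d}{\mathrm dt}\mathcal E(\Theta,X)\le-\mathcal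 E(\Theta,X)-\frac{\mu_f}{2}\|x'\|^2-\frac{\mu_g}{2}\|y'\|^2,$$ and consequently, for all $0\le t<\infty$, $$2e^{t}\mathcal E(\Theta(t),X(t))+\int_0^te^{s}\left(\mu_f\|x'(s)\|^2+\mu_g\|y'(s)\|^2\right)\mathrm ds\le 2\,\mathcal E(\Theta(0),X(0)).$$
   Context: $\langle\cdot,\cdot\rangle$ and $\|\cdot\|$ are the Euclidean inner product and norm. For $0\le\mu$ and $L$, $f\in\mathcal S^{1,1}_{\mu,L}$ means that $f$ is a differentiable convex function on the whole space with $\frac{\mu}{2}\|x_1-x_2\|^2\le f(x_1)-f(x_2)-\langle\nabla f(x_2),x_1-x_2\rangle\le\frac{L}{2}\|x_1-x_2\|^2$ for all $x_1,x_2$ (i.e. $f$ is $\mu$-strongly convex with $L$-Lipschitz gradient). $(x^*,y^*,\lambda^* )$ is a saddle point of $\mathcal L$ if $\mathcal L(x^*,y^*,\lambda)\le\mathcal L(x^*,y^*,\lambda^* )\le\mathcal L(x,y,\lambda^* )$ for all $(x,y,\lambda)\in\mathbb R^m\times\mathbb R^n\times\mathbb R^r$. Its existence is a standing assumption. *)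

(* Defs.v *)
From HB Require Import structures.
From mathcomp Require Import all_boot all_order all_algebra.
From mathcomp Require Import all_classical all_reals all_analysis.
Import Order.TTheory GRing.Theory Num.Theory.
Import numFieldNormedType.Exports.

Set Implicit Arguments.
Unset Strict Implicit.
Unset Printing Implicit Defensive.

Local Open Scope classical_set_scope.
Local Open Scope ring_scope.

(* The norm `|u| of a matrix type is the sup norm, hence a separate Euclidean
   norm. Both induce the same topology, so that limits, continuity and
   differentiability are those of the library. *)
Definition dot (R : realType) n (u v : 'cV[R]_n) : R :=
  \sum_i u i 0 * v i 0.

Definition enorm (R : realType) n (u : 'cV[R]_n) : R := Num.sqrt (dot u u).

Definition grad (R : realType) n (f : 'cV[R]_n -> R) (x : 'cV[R]_n) :
  'cV[R]_n := \col_i 'D_(delta_mx i 0) f x.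

Definition S11 (R : realType) n (mu L : R) (f : 'cV[R]_n -> R) : Prop :=
  [/\ forall x, differentiable f x,
      convex_function (E := 'cV[R]_n) setT f &
      forall x1 x2 : 'cV[R]_n,
        let gap := f x1 - f x2 - dot (grad f x2) (x1 - x2) in
        mu / 2 * enorm (x1 - x2) ^+ 2 <= gap <= L / 2 * enorm (x1 - x2) ^+ 2].

(* Derivative of a curve defined on [0, +oo[: the limit of the difference
   quotients taken along [0, +oo[. It is one-sided at 0 and is the usual
   derivative at t > 0; values of the curve at negative times are irrelevant. *)
Section curve_derivative.
Context {R : realType} {V : normedModType R}.
Implicit Types (c : R -> V) (t : R).

Definition diffquo0y c t : set_system V :=
  (s - t)^-1 *: (c s - c t) @[s --> within `[0, +oo[ t^'].

Definition derivable0y c t : Prop := cvg (diffquo0y c t).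

Definition derive0y c t : V := lim (diffquo0y c t).

Definition C1_0y c : Prop :=
  (forall t, 0 <= t -> derivable0y c t) /\
  {within `[0, +oo[, continuous (derive0y c)}.

End curve_derivative.

Definition lagrangian (R : realType) m n r
    (f : 'cV[R]_m -> R) (g : 'cV[R]_n -> R)
    (A : 'M[R]_(r, m)) (B : 'M[R]_(r, n)) (b : 'cV[R]_r)
    (x : 'cV[R]_m) (y : 'cV[R]_n) (lam : 'cV[R]_r) : R :=
  f x + g y + dot lam (A *m x + B *m y - b).

Section primal_dual.
Context {R : realType} {m n r : nat}.
Variable Lag : 'cV[R]_m -> 'cV[R]_n -> 'cV[R]_r -> R.

Definition saddle_point (xs : 'cV[R]_m) (ys : 'cV[R]_n) (ls : 'cV[R]_r) :
    Prop :=
  forall x y lam, Lag xs ys lam <= Lag xs ys ls <= Lag x y ls.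

Definition scaling_solution (muf mug gamma0 beta0 : R)
    (theta gamma beta : R -> R) : Prop :=
  [/\ theta 0 = 1, gamma 0 = gamma0, beta 0 = beta0 &
      forall t, 0 <= t ->
        [/\ derivable0y theta t /\ derive0y theta t = - theta t,
            derivable0y gamma t /\ derive0y gamma t = muf - gamma t &
            derivable0y beta t /\ derive0y beta t = mug - beta t]].

Definition flow_solution (muf mug : R) (theta gamma beta : R -> R)
    (x : R -> 'cV[R]_m) (y : R -> 'cV[R]_n)
    (v : R -> 'cV[R]_m) (w : R -> 'cV[R]_n) (lam : R -> 'cV[R]_r) : Prop :=
  [/\ C1_0y x, C1_0y y, C1_0y v, C1_0y w & C1_0y lam] /\
  forall t, 0 <= t ->
    [/\ derive0y x t = v t - x t,
        gamma t *: derive0y v t =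
          muf *: (x t - v t) - grad (fun x' => Lag x' (y t) (lam t)) (x t),
        theta t *: derive0y lam t =
          grad (fun lam' => Lag (v t) (w t) lam') (lam t),
        beta t *: derive0y w t =
          mug *: (y t - w t) - grad (fun y' => Lag (x t) y' (lam t)) (y t) &
        derive0y y t = w t - y t].

Definition lyapunov (xs : 'cV[R]_m) (ys : 'cV[R]_n) (ls : 'cV[R]_r)
    (theta gamma beta : R)
    (x : 'cV[R]_m) (y : 'cV[R]_n) (v : 'cV[R]_m) (w : 'cV[R]_n)
    (lam : 'cV[R]_r) : R :=
  Lag x y ls - Lag xs ys lam
  + theta / 2 * enorm (lam - ls) ^+ 2
  + beta / 2 * enorm (w - ys) ^+ 2
  + gamma / 2 * enorm (v - xs) ^+ 2.

End primal_dual.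

(* Main.v *)
Require Import Defs.
From HB Require Import structures.
From mathcomp Require Import all_boot all_order all_algebra.
From mathcomp Require Import all_classical all_reals all_analysis.
From mathcomp Require Import ring lra.
Import Order.TTheory GRing.Theory Num.Theory.
Import numFieldNormedType.Exports.

Set Implicit Arguments.
Unset Strict Implicit.
Unset Printing Implicit Defensive.

Local Open Scope classical_set_scope.
Local Open Scope ring_scope.
(* Writing [p = grad f x], the flow gives
     <p + A^T ls, v - x> + <gamma v', v - xs>
       = <p, xs - x> - <ls, A (x - xs)> - <A (v - xs), lam - ls>
         + muf <x - v, v - xs>,
   strong convexity bounds [<p, xs - x>] by [f xs - f x - muf/2 |x - xs|^2],
   and polarization of [<x - v, v - xs>] cancels [|x - xs|^2] while producing
   [- muf/2 |x'|^2]. The same holds for [g]; the coupling terms cancel against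
   [theta <lam', lam - ls>] since a saddle point is feasible. Hence
   [(2 e^t E)' <= - e^t (muf |x'|^2 + mug |y'|^2)], and the function
   [t |-> 2 e^t E t + \int_0^t e^s (muf |x'|^2 + mug |y'|^2) ds] is
   nonincreasing. *)

(** * Derivatives of curves on the half-line *)

Section curve_derivative.
Context {R : realType} {V : normedModType R}.
Implicit Types (c : R -> V) (t : R) (d : V).

(** The set [F] is a parameter so that [[0, +oo[] and [setT] give the one-sided and the two-sided
    derivative a common epsilon-delta form. *)
Lemma cvg_diffquoP c t d (F : set R) :
  (s - t)^-1 *: (c s - c t) @[s --> within F t^'] --> d <->
  forall e : R, 0 < e -> exists2 del : R, 0 < del &
    forall s, F s -> s != t -> `|s - t| < del ->
      `|d - (s - t)^-1 *: (c s - c t)| <= e.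
Proof.
split=> [/cvgrPdist_le cd e e0|cd].
  have /nbhs_ballP[del /= del0 H] := cd e e0.
  by exists del => // s Fs st sd; apply: H => //; rewrite /ball/= distrC.
apply/cvgrPdist_le => e e0; have [del del0 H] := cd e e0.
apply/nbhs_ballP; exists del => //= s sd st Fs; apply: H => //.
by rewrite distrC.
Qed.

Lemma is_derive_diffquoP c t d :
  is_derive t 1 c d <->
  (s - t)^-1 *: (c s - c t) @[s --> within setT t^'] --> d.
Proof.
have shiftE s : (s - t) *: (1 : R) + t = s by rewrite /GRing.scale/= mulr1 subrK.
split=> [cd|/cvg_diffquoP cd].
  apply/cvg_diffquoP => e e0.
  have : h^-1 *: (c (h *: 1 + t) - c t) @[h --> 0^'] --> d.
    by rewrite -(@derive_val _ _ _ _ _ _ _ cd); exact: ex_derive.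
  move=> /cvgrPdist_le/(_ e e0)/nbhs_ballP[del /= del0 H].
  exists del => // s _ st sd.
  have := H (s - t); rewrite shiftE; apply; last by rewrite subr_eq0.
  by rewrite /ball/= sub0r normrN.
have {}cd : h^-1 *: (c (h *: 1 + t) - c t) @[h --> 0^'] --> d.
  apply/cvgrPdist_le => e e0; have [del del0 H] := cd e e0.
  apply/nbhs_ballP; exists del => //= h hd h0.
  have := H (h + t) I; rewrite addrK /GRing.scale/= mulr1; apply => //.
    by rewrite -subr_eq0 addrK.
  by move: hd; rewrite /ball/= sub0r normrN.
apply: DeriveDef; first by apply/cvg_ex; exists d.
exact/cvg_lim.
Qed.

Lemma cvg_diffquo0y c t d : 0 <= t -> diffquo0y c t --> d ->
  derivable0y c t /\ derive0y c t = d.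
Proof.
move=> t0 cd; split; first by apply/cvg_ex; exists d.
(* Uniqueness of limits needs a proper filter: every ball of radius [e] around [t] contains
   [t + e / 2], a point of [[0, +oo[] other than [t]. *)
have PF : ProperFilter (within `[0, +oo[ t^').
  split; last exact: within_filter.
  move=> /nbhs_ballP[e /= e0 H].
  apply: (H (t + e / 2)) => /=.
  - rewrite /ball/= opprD addrA subrr sub0r normrN gtr0_norm ?divr_gt0//.
    by rewrite ltr_pdivrMr// mulr2n mulrDr mulr1 ltrDl.
  - by rewrite -subr_eq0 addrAC subrr add0r gt_eqF// divr_gt0.
  - by rewrite in_itv/= andbT addr_ge0// divr_ge0// ltW.
exact: (@cvg_lim _ (@norm_hausdorff _ _)).
Qed.

(** The quotients only see nonnegative arguments, so the two-sided derivative of any extension of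
    [c1] passes to [c1]. *)
Lemma is_derive_derive0y c1 c2 t d :
  (forall s, 0 <= s -> c1 s = c2 s) -> 0 <= t -> is_derive t 1 c2 d ->
  derivable0y c1 t /\ derive0y c1 t = d.
Proof.
move=> c12 t0 /is_derive_diffquoP/cvg_diffquoP cd.
apply: cvg_diffquo0y => //; apply/cvg_diffquoP => e e0.
have [del del0 H] := cd e e0; exists del => // s.
by rewrite /= in_itv/= andbT => s0 st sd; rewrite !c12//; exact: H.
Qed.

(* Prolonging a curve along its tangent at [0] makes the one-sided derivatives
   on [0, +oo[ two-sided, so that the usual rules apply, also at [0]. *)
Definition tangent_ext c : R -> V :=
  fun s => if 0 <= s then c s else c 0 + s *: derive0y c 0.

Lemma tangent_extE c s : 0 <= s -> tangent_ext c s = c s.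
Proof. by rewrite /tangent_ext => ->. Qed.

Lemma is_derive_tangent_ext c t : 0 <= t -> derivable0y c t ->
  is_derive t 1 (tangent_ext c) (derive0y c t).
Proof.
move=> t0 /cvg_ex[d cd]; have [_ dE] := cvg_diffquo0y t0 cd.
apply/is_derive_diffquoP/cvg_diffquoP => e e0; rewrite tangent_extE// dE.
move/cvg_diffquoP : cd => /(_ e e0)[del del0 H].
(* At [t = 0] the quotients at negative [s] equal the tangent exactly; for [t > 0] a radius of at
   most [t] keeps [s] nonnegative. *)
move: t0; rewrite le_eqVlt => /predU1P[t0|t0].
  exists del => // s _ st sd; rewrite /tangent_ext; case: ifPn => s0.
    by apply: H => //; rewrite /= in_itv/= andbT.
  rewrite -t0 subr0 addrAC subrr add0r scalerA mulVf; last by rewrite t0.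
  by rewrite {1}t0 dE scale1r subrr normr0 ltW.
exists (Num.min del t); first by rewrite lt_min del0.
move=> s _ st; rewrite lt_min => /andP[sd sd'].
have s0 : 0 <= s by move: sd'; rewrite ltr_norml => /andP[+ _]; lra.
by rewrite tangent_extE//; apply: H => //; rewrite /= in_itv/= andbT.
Qed.

End curve_derivative.

(** * Algebra of the Euclidean inner product *)

Section dot_theory.
Context {R : realType} {n : nat}.
Implicit Types u v w : 'cV[R]_n.

Lemma dotC u v : dot u v = dot v u.
Proof. by apply: eq_bigr => i _; rewrite mulrC. Qed.

Lemma dotDl u v w : dot (u + v) w = dot u w + dot v w.
Proof. by rewrite -big_split; apply: eq_bigr => i _; rewrite mxE mulrDl. Qed.

Lemma dotNl u w : dot (- u) w = - dot u w.
Proof. by rewrite -sumrN; apply: eq_bigr => i _; rewrite mxE mulNr. Qed.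

Lemma dotZl (a : R) u w : dot (a *: u) w = a * dot u w.
Proof. by rewrite mulr_sumr; apply: eq_bigr => i _; rewrite mxE mulrA. Qed.

Lemma dotDr u v w : dot w (u + v) = dot w u + dot w v.
Proof. by rewrite dotC dotDl !(dotC w). Qed.

Lemma dotNr u w : dot w (- u) = - dot w u.
Proof. by rewrite dotC dotNl (dotC w). Qed.

Lemma dotZr (a : R) u w : dot w (a *: u) = a * dot w u.
Proof. by rewrite dotC dotZl (dotC w). Qed.

Lemma dot0l u : dot 0 u = 0.
Proof. by rewrite /dot big1// => i _; rewrite mxE mul0r. Qed.

Lemma dot0r u : dot u 0 = 0.
Proof. by rewrite dotC dot0l. Qed.

Definition dotE := (dotDl, dotDr, dotNl, dotNr, dotZl, dotZr).

Lemma dot_deltar u i : dot u (delta_mx i 0) = u i 0.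
Proof.
rewrite /dot (bigD1 i)//= big1 => [|j ji]; first by rewrite mxE !eqxx mulr1 addr0.
by rewrite mxE (negPf ji) mulr0.
Qed.

Lemma dot_ge0 u : 0 <= dot u u.
Proof. by apply: sumr_ge0 => i _; rewrite -expr2 sqr_ge0. Qed.

Lemma dot_eq0 u : dot u u = 0 -> u = 0.
Proof.
move=> /eqP; rewrite psumr_eq0 => [|i _]; last by rewrite -expr2 sqr_ge0.
move=> /allP u0; apply/colP => i; rewrite mxE; apply/eqP.
by have := u0 i (mem_index_enum _); rewrite /= mulf_eq0 orbb.
Qed.

Lemma enorm_sqr u : enorm u ^+ 2 = dot u u.
Proof. by rewrite /enorm sqr_sqrtr ?dot_ge0. Qed.

End dot_theory.

Lemma dot_mulmx (R : realType) m n (l : 'cV[R]_m) (A : 'M[R]_(m, n))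
    (u : 'cV[R]_n) :
  dot l (A *m u) = dot (A^T *m l) u.
Proof.
rewrite /dot; under eq_bigr do rewrite mxE mulr_sumr.
rewrite exchange_big; apply: eq_bigr => j _; rewrite mxE mulr_suml.
by apply: eq_bigr => i _; rewrite mxE mulrA (mulrC (A i j)).
Qed.

(** * Gradients, inner products and the chain rule *)

Section gradient.
Context {R : realType} {n : nat}.

Lemma is_derive_coord (U : normedModType R) (c : U -> 'cV[R]_n) x v d i :
  is_derive x v c d -> is_derive x v (fun z => c z i 0) (d i 0).
Proof.
move=> cd; have dc : derivable c x v by exact: ex_derive.
apply: DeriveDef; first exact: (derivable_mxP c x v).1.
by rewrite -(@derive_val _ _ _ _ _ _ _ cd) derive_mx// mxE.
Qed.

Lemma is_derive_dot (U : normedModType R) (c1 c2 : U -> 'cV[R]_n) x v d1 d2 :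
  is_derive x v c1 d1 -> is_derive x v c2 d2 ->
  is_derive x v (fun z => dot (c1 z) (c2 z)) (dot d1 (c2 x) + dot (c1 x) d2).
Proof.
move=> cd1 cd2.
have -> : (fun z => dot (c1 z) (c2 z)) =
    \sum_(i < n) ((fun z => c1 z i 0) * (fun z => c2 z i 0) : U -> R).
  by apply/funext => z; rewrite fct_sumE.
rewrite -big_split/=; apply: is_derive_sum => i.
apply: (is_derive_eq (is_deriveM (is_derive_coord i cd1) (is_derive_coord i cd2))).
by rewrite addrC; congr (_ + _); exact: mulrC.
Qed.

(** [grad] only collects partial derivatives; the differential is linear, so expanding [u] in the
    basis [delta_mx i 0] brings it back to them. *)
Lemma diff_grad (f : 'cV[R]_n -> R) x u :
  differentiable f x -> 'd f x u = dot (grad f x) u.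
Proof.
move=> df; rewrite {1}(_ : u = \sum_i u i 0 *: delta_mx i 0); last first.
  apply/colP => i; rewrite summxE (bigD1 i)//= big1 => [|j ji].
    by rewrite !mxE !eqxx mulr1 addr0.
  by rewrite !mxE eq_sym (negPf ji) mulr0.
rewrite linear_sum; apply: eq_bigr => i _.
by rewrite linearZ/= mxE deriveE// mulrC.
Qed.

Lemma is_derive_grad (f : 'cV[R]_n -> R) (c : R -> 'cV[R]_n) (t : R) d :
  differentiable f (c t) -> is_derive t 1 c d ->
  is_derive t 1 (fun s => f (c s)) (dot (grad f (c t)) d).
Proof.
move=> df cd.
have dc : differentiable c t by apply/derivable1_diffP; exact: ex_derive.
apply: DeriveDef.
  by apply/derivable1_diffP; exact: differentiable_comp.
rewrite deriveE; last exact: differentiable_comp.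
rewrite (diff_comp dc df)/= diff_grad// -deriveE//.
by rewrite (@derive_val _ _ _ _ _ _ _ cd).
Qed.

(** Each partial map of the Lagrangian is a function plus a linear form plus a constant, so this
    formula serves all three partial gradients. *)
Lemma grad_affine (f : 'cV[R]_n -> R) a k x : differentiable f x ->
  grad (fun z => f z + dot a z + k) x = grad f x + a.
Proof.
move=> df; apply/colP => i; rewrite !mxE.
have d1 : is_derive x (delta_mx i 0) f ('D_(delta_mx i 0) f x).
  by apply/derivableP/diff_derivable.
have d2 := is_derive_dot (is_derive_cst a x (delta_mx i 0))
                         (is_derive_id x (delta_mx i 0)).
have d3 := is_deriveD (is_deriveD d1 d2) (is_derive_cst k x (delta_mx i 0)).
rewrite (_ : (fun _ => _) = f + (fun z => dot (cst a z) (id z)) + cst k)//.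
rewrite (@derive_val _ _ _ _ _ _ _ d3).
by rewrite addr0 dot0l add0r dot_deltar.
Qed.

End gradient.

(** With [F] the primitive of [k] vanishing at 0, [G + F] has derivative [dG + k <= 0] on []0, t[]
    and is continuous on [[0, t]], hence is nonincreasing there. *)
Lemma le_sub_integral (R : realType) (G dG k : R -> R) (t : R) :
  (forall s : R, 0 <= s -> is_derive s 1 G (dG s)) ->
  (forall s : R, 0 <= s -> {for s, continuous k}) ->
  (forall s : R, 0 <= s -> dG s <= - k s) -> 0 <= t ->
  ((G t)%:E + \int[lebesgue_measure]_(s in `[0%R, t]) (k s)%:E <= (G 0)%:E)%E.
Proof.
move=> dGE kc dGk t0.
have kint : lebesgue_measure.-integrable `[0, t] (EFin \o k).
  apply: continuous_compact_integrable; first exact: segment_compact.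
  apply: continuous_in_subspaceT => s; rewrite inE/= in_itv/= => /andP[s0 _].
  exact: kc.
pose F (s : R) := parameterized_integral lebesgue_measure 0 s k.
have dF (s : R) : s \in `]0, t[ -> derivable F s 1 /\ F^`()%classic s = k s.
  rewrite in_itv/= => /andP[s0 st].
  exact: (continuous_FTC1_closed st kint s0 (kc _ (ltW s0))).
have dGF (s : R) : s \in `]0, t[ -> is_derive s 1 (G + F) (dG s + k s).
  move=> st; have [dFs <-] := dF s st.
  rewrite derive1E; apply: is_deriveD; last exact: derivableP.
  by apply: dGE; move: st; rewrite in_itv/= => /andP[/ltW].
have : (G + F) t <= (G + F) 0.
  apply: (@ler0_derive1_le_cc _ _ 0 t); rewrite ?in_itv/= ?lexx ?t0//.
  - by move=> s /dGF st; exact: ex_derive.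
  - move=> s st; have dGFs := dGF s st.
    rewrite derive1E derive_val -(opprK (k s)) subr_le0 dGk//.
    by move: st; rewrite in_itv/= => /andP[/ltW].
  - apply: within_continuousD; last exact: parameterized_integral_continuous.
    apply: derivable_within_continuous => s; rewrite in_itv/= => /andP[s0 _].
    by have dGs := dGE s s0; exact: ex_derive.
have -> : (G + F) 0 = G 0.
  by rewrite fctE /F /parameterized_integral set_itv1 Rintegral_set1 addr0.
rewrite fctE => GF.
(* [F] is a real-valued integral and the goal an extended real one; they agree because [k] is
   integrable. *)
rewrite -(@fineK _ (\int[_]_(s in _) _)%E); first by rewrite -EFinD lee_fin.
exact: integrable_fin_num.
Qed.

(* The coupling terms [dot ls (A *m _)] and [dot (A *m _) (lam - ls)] of the
   two primal blocks add up to those of the Lagrangian, because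
   [A *m xs + B *m ys = b]. *)
Lemma primal_block_decay (R : realType) m r (mu ga fx fs : R)
    (A : 'M[R]_(r, m)) (x v dv xs p : 'cV[R]_m) (lam ls : 'cV[R]_r) :
  ga *: dv = mu *: (x - v) - (p + A^T *m lam) ->
  mu / 2 * dot (xs - x) (xs - x) <= fs - fx - dot p (xs - x) ->
  dot p (v - x) + dot ls (A *m (v - x)) + dot (A *m (v - xs)) (lam - ls)
    + ((mu - ga) / 2 * dot (v - xs) (v - xs) + ga * dot dv (v - xs)) <=
  - (fx - fs + dot ls (A *m (x - xs)) + ga / 2 * dot (v - xs) (v - xs))
    - mu / 2 * dot (v - x) (v - x).
Proof.
move=> dvE; rewrite -(dotZl ga) dvE ![dot (A *m _) _]dotC !dot_mulmx.
rewrite !(mulmxDr, mulmxN, dotE).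
rewrite (dotC v x) (dotC xs x) (dotC xs v).
lra.
Qed.

(** Symmetry of [dot] makes the product rule yield the same term twice, which the factor 1/2
    absorbs. *)
Lemma is_derive_weighted_sqdist (R : realType) n (a : R -> R)
    (u : R -> 'cV[R]_n) k (t : R) da du :
  is_derive t 1 a da -> is_derive t 1 u du ->
  is_derive t 1 (fun s => a s / 2 * dot (u s - k) (u s - k))
    (da / 2 * dot (u t - k) (u t - k) + a t * dot du (u t - k)).
Proof.
move=> dat dut.
have duk : is_derive t 1 (fun s => u s - k) du.
  rewrite (_ : (fun _ => _) = u - cst k)//.
  by apply: (is_derive_eq (is_deriveB dut (is_derive_cst k t 1))); rewrite subr0.
rewrite (_ : (fun _ => _) = 2^-1 \*: (a * (fun s => dot (u s - k) (u s - k)))).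
  apply: (is_derive_eq (is_deriveZ 2^-1 (is_deriveM dat (is_derive_dot duk duk)))).
  rewrite (dotC _ du) /GRing.scale/=; lra.
apply/funext => s; transitivity (2^-1 * (a s * dot (u s - k) (u s - k))) => //.
by rewrite mulrA (mulrC _ (a s)).
Qed.

(** * Feasibility of saddle points and partial gradients of the Lagrangian *)

Section saddle.
Context {R : realType} {m n r : nat}.
Variables (f : 'cV[R]_m -> R) (g : 'cV[R]_n -> R).
Variables (A : 'M[R]_(r, m)) (B : 'M[R]_(r, n)) (b : 'cV[R]_r).
Local Notation Lag := (lagrangian f g A B b).

(** Moving the multiplier from [ls] by the residual [A *m xs + B *m ys - b] raises the Lagrangian by
    the squared norm of that residual, which the saddle inequality forces to be at most 0. *)
Lemma saddle_point_feasible xs ys ls :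
  saddle_point Lag xs ys ls -> A *m xs + B *m ys = b.
Proof.
move=> /(_ xs ys (ls + (A *m xs + B *m ys - b)))/andP[+ _].
rewrite /lagrangian lerD2l [leLHS]dotDl -subr_ge0 opprD addrA subrr sub0r oppr_ge0.
move=> c0; apply/eqP; rewrite -subr_eq0; apply/eqP/dot_eq0/eqP.
by rewrite eq_le c0 dot_ge0.
Qed.

Lemma grad_lagrangian_x x y lam : differentiable f x ->
  grad (fun x' => Lag x' y lam) x = grad f x + A^T *m lam.
Proof.
move=> df; rewrite -(grad_affine _ (g y + dot lam (B *m y - b)) df).
congr (grad _ x); apply/funext => z.
by rewrite /lagrangian !dotE dot_mulmx; ring.
Qed.

Lemma grad_lagrangian_y x y lam : differentiable g y ->
  grad (fun y' => Lag x y' lam) y = grad g y + B^T *m lam.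
Proof.
move=> dg; rewrite -(grad_affine _ (f x + dot lam (A *m x - b)) dg).
congr (grad _ y); apply/funext => z.
by rewrite /lagrangian !dotE (dot_mulmx _ B); ring.
Qed.

Lemma grad_lagrangian_lam x y lam :
  grad (fun lam' => Lag x y lam') lam = A *m x + B *m y - b.
Proof.
(* The Lagrangian is affine in the multiplier, so [grad_affine] is applied with the zero
   function. *)
have <- : grad (cst 0) lam + (A *m x + B *m y - b) = A *m x + B *m y - b.
  by rewrite [grad _ _](_ : _ = 0) ?add0r//; apply/colP => i; rewrite !mxE derive_cst.
rewrite -(grad_affine _ (f x + g y)); last exact: differentiable_cst.
by congr (grad _ lam); apply/funext => z; rewrite /lagrangian add0r addrC dotC.
Qed.

End saddle.

(** * Exponential decay of the Lyapunov function *)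

Theorem theorem2p1 (R : realType) (m n r : nat)
    (muf Lf mug Lg : R) (f : 'cV[R]_m -> R) (g : 'cV[R]_n -> R)
    (A : 'M[R]_(r, m)) (B : 'M[R]_(r, n)) (b : 'cV[R]_r)
    (xs : 'cV[R]_m) (ys : 'cV[R]_n) (ls : 'cV[R]_r)
    (gamma0 beta0 : R) (theta gamma beta : R -> R)
    (x : R -> 'cV[R]_m) (y : R -> 'cV[R]_n)
    (v : R -> 'cV[R]_m) (w : R -> 'cV[R]_n) (lam : R -> 'cV[R]_r)
    (Lag := lagrangian f g A B b)
    (E := fun t : R => lyapunov Lag xs ys ls (theta t) (gamma t) (beta t)
                         (x t) (y t) (v t) (w t) (lam t)) :
  0 <= muf -> 0 <= mug ->
  S11 muf Lf f -> S11 mug Lg g ->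
  saddle_point Lag xs ys ls ->
  0 < gamma0 -> 0 < beta0 ->
  scaling_solution muf mug gamma0 beta0 theta gamma beta ->
  flow_solution Lag muf mug theta gamma beta x y v w lam ->
  (forall t : R, 0 <= t ->
     derivable0y E t /\
     derive0y E t <=
       - E t - muf / 2 * enorm (derive0y x t) ^+ 2
             - mug / 2 * enorm (derive0y y t) ^+ 2) /\
  (forall t : R, 0 <= t ->
     ((2 * expR t * E t)%:E
      + \int[lebesgue_measure]_(s in `[0%R, t])
          (expR s * (muf * enorm (derive0y x s) ^+ 2
                     + mug * enorm (derive0y y s) ^+ 2))%:E
      <= (2 * E 0)%:E)%E).
Proof.
move=> _ _ [df _ fgap] [dg _ ggap] sp _ _ [_ _ _ sc].
move=> [[[cx _] [cy _] [cv _] [cw _] [cl _]] fl].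
have bE := saddle_point_feasible sp.
pose X := tangent_ext x; pose Y := tangent_ext y; pose V := tangent_ext v.
pose W := tangent_ext w; pose L := tangent_ext lam.
pose Th := tangent_ext theta; pose Ga := tangent_ext gamma.
pose Be := tangent_ext beta.
(* By feasibility the Lagrangian at [(xs, ys)] is [f xs + g ys] for every multiplier; transposition
   turns the coupling with [ls] into linear forms in [X] and [Y]. *)
pose Ee (s : R) := f (X s) + g (Y s)
    + (dot (A^T *m ls) (X s) + dot (B^T *m ls) (Y s))
    - (dot ls b + (f xs + g ys))
  + (Th s / 2 * dot (L s - ls) (L s - ls)
    + Be s / 2 * dot (W s - ys) (W s - ys)
    + Ga s / 2 * dot (V s - xs) (V s - xs)).
have EE (s : R) : 0 <= s -> E s = Ee s.
  move=> s0; rewrite /E /Ee /lyapunov /Lag /lagrangian !enorm_sqr.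
  rewrite /X /Y /V /W /L /Th /Ga /Be !tangent_extE//.
  by rewrite bE subrr dot0r -!dot_mulmx 2!(dotDr _ _ ls) (dotNr b ls); ring.
(* The derivative of [Ee], with those of [theta], [beta] and [gamma] already replaced by the scaling
   equations. *)
pose Ed (s : R) := dot (grad f (X s)) (derive0y x s)
    + dot (grad g (Y s)) (derive0y y s)
    + (dot (A^T *m ls) (derive0y x s) + dot (B^T *m ls) (derive0y y s))
  + (- theta s / 2 * dot (L s - ls) (L s - ls)
       + Th s * dot (derive0y lam s) (L s - ls)
    + ((mug - beta s) / 2 * dot (W s - ys) (W s - ys)
       + Be s * dot (derive0y w s) (W s - ys))
    + ((muf - gamma s) / 2 * dot (V s - xs) (V s - xs)
       + Ga s * dot (derive0y v s) (V s - xs))).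
have dE (s : R) : 0 <= s -> is_derive s 1 Ee (Ed s).
  move=> s0; have [[cth dth] [cga dga] [cbe dbe]] := sc s s0.
  have dX := is_derive_tangent_ext s0 (cx s s0).
  have dY := is_derive_tangent_ext s0 (cy s s0).
  have dV := is_derive_tangent_ext s0 (cv s s0).
  have dW := is_derive_tangent_ext s0 (cw s s0).
  have dL := is_derive_tangent_ext s0 (cl s s0).
  have := is_derive_tangent_ext s0 cth; rewrite dth => dTh.
  have := is_derive_tangent_ext s0 cga; rewrite dga => dGa.
  have := is_derive_tangent_ext s0 cbe; rewrite dbe => dBe.
  have d1 := is_deriveD (is_derive_grad (df _) dX) (is_derive_grad (dg _) dY).
  have d2 := is_deriveD
    (is_derive_dot (is_derive_cst (A^T *m ls) s (1 : R)) dX)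
    (is_derive_dot (is_derive_cst (B^T *m ls) s (1 : R)) dY).
  have d3 := is_derive_cst (dot ls b + (f xs + g ys)) s (1 : R).
  have d4 := is_deriveD (is_deriveD
     (is_derive_weighted_sqdist ls dTh dL)
     (is_derive_weighted_sqdist ys dBe dW))
     (is_derive_weighted_sqdist xs dGa dV).
  apply: (is_derive_eq (is_deriveD (is_deriveB (is_deriveD d1 d2) d3) d4)).
  by rewrite subr0 !dot0l !add0r.
have Edle (s : R) : 0 <= s -> Ed s <=
    - Ee s - muf / 2 * enorm (derive0y x s) ^+ 2
           - mug / 2 * enorm (derive0y y s) ^+ 2.
  move=> s0; have [xE vE lE wE yE] := fl s s0.
  rewrite grad_lagrangian_x// in vE; rewrite grad_lagrangian_y// in wE.
  rewrite grad_lagrangian_lam in lE.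
  (* The base point is [x s], where the flow evaluates the gradient. *)
  have := fgap xs (x s); rewrite enorm_sqr => /andP[fs _].
  have := ggap ys (y s); rewrite enorm_sqr => /andP[gs _].
  have px := primal_block_decay ls vE fs.
  have py := primal_block_decay ls wE gs.
  rewrite /Ed /Ee !enorm_sqr /X /Y /V /W /L /Th /Ga /Be !tangent_extE//.
  rewrite xE yE -(dotZl (theta s)) lE.
  rewrite -bE -!dot_mulmx.
  (* In this form the multiplier equation splits into exactly the two coupling terms of [px] and
     [py]. *)
  have -> : A *m v s + B *m w s - (A *m xs + B *m ys) =
      A *m (v s - xs) + B *m (w s - ys).
    by rewrite !mulmxBr opprD addrACA.
  rewrite !(mulmxBr, dotE) in px py *.
  lra.
split=> t t0.
  have [dEt ->] := is_derive_derive0y EE t0 (dE t t0).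
  by rewrite EE//; split=> //; exact: Edle.
have dG (s : R) : 0 <= s ->
    is_derive s 1 ((2 \*: expR) * Ee) (2 * expR s * (Ed s + Ee s)).
  move=> s0.
  apply: (is_derive_eq (is_deriveM (is_deriveZ 2 (is_derive_expR s)) (dE s s0))).
  transitivity (2 * expR s * Ed s + Ee s * (2 * expR s)) => //; ring.
(* Replacing [x'] by [v - x] and [y'] by [w - y] on extended curves gives an integrand that is
   continuous on both sides of 0. *)
pose k (s : R) := expR s * (muf * dot (V s - X s) (V s - X s)
  + mug * dot (W s - Y s) (W s - Y s)).
have kE (s : R) : 0 <= s -> k s = expR s * (muf * enorm (derive0y x s) ^+ 2
                     + mug * enorm (derive0y y s) ^+ 2).
  move=> s0; have [xE _ _ _ yE] := fl s s0.
  by rewrite /k !enorm_sqr xE yE /X /Y /V /W !tangent_extE.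
have kc (s : R) : 0 <= s -> {for s, continuous k}.
  move=> s0; apply: differentiable_continuous; apply/derivable1_diffP.
  have dVX := is_deriveB (is_derive_tangent_ext s0 (cv s s0))
    (is_derive_tangent_ext s0 (cx s s0)).
  have dWY := is_deriveB (is_derive_tangent_ext s0 (cw s s0))
    (is_derive_tangent_ext s0 (cy s s0)).
  have := is_deriveM (is_derive_expR s) (is_deriveD
    (is_deriveZ muf (is_derive_dot dVX dVX))
    (is_deriveZ mug (is_derive_dot dWY dWY))).
  by move=> dk; exact: (@ex_derive _ _ _ _ _ _ _ dk).
have dGk (s : R) : 0 <= s -> 2 * expR s * (Ed s + Ee s) <= - k s.
  move=> s0; rewrite kE// -subr_ge0.
  (* Multiplying the decay inequality by [2 * expR s] clears the halves. *)
  have := Edle s s0; have := expR_gt0 s; nra.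
have := le_sub_integral dG kc dGk t0.
rewrite !fctE /= expR0.
under eq_integral => s.
  rewrite inE/= in_itv/= => /andP[s0 _]; rewrite (kE s s0); over.
by rewrite /GRing.scale/= mulr1 -!EE.
Qed.
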